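(* Let $(L_n^\varepsilon)_{n\in\mathbb Z}$, $\varepsilon\in[0,\varepsilon_0)$, be a family of operators as in the context (uniformly bounded on $B_s$ and on $B_w$, positive, and mass preserving: $(L_n^\varepsilon\mu)(X)=\mu(X)$ for all $\mu\in B_s$). Assume: (i) (weak power-boundedness) $\mathbb T_\varepsilon$ maps $\mathcal V_w$ into itself and there is $M_w\ge 1$ with $\|\mathbb T_\varepsilon^k\|_{\mathcal V_w\to\mathcal V_w}\le M_w$ for all $k\ge0$ and all $\varepsilon\in[0,\varepsilon_0)$; (ii) (uniform strong bounds) for each $\varepsilon\in[0,\varepsilon_0)$ there is an equivariant family $\boldsymbol\mu^\varepsilon=(\mu^\varepsilon_n)_{n\in\mathbb Z}\in\mathcal B_s$ of probability measures, $\mu^\varepsilon_{n+1}=L^\varepsilon_n\mu^\varepsilon_n$ for all $n$, and $\sup_{\varepsilon\in[0,\varepsilon_0)}\sup_{n}\|\mu_n^\varepsilon\|_s<\infty$; (iii) (strong differentiability) there is a sequence of elements $g_n=\dot L_n\mu_n^0\in B_s$, $n\in\mathbb Z$ (the symbol $\dot L_n\mu^0_n$ just denotes this element), with $\sup_n\|\dot L_n\mu_n^0\|_s<\infty$, $$\lim_{\varepsilon\to0}\ \sup_{n\in\mathbb Z}\left\|\frac{L_n^\varepsilon\mu_n^0-L_n^0\mu_n^0}{\varepsilon}-\dot L_n\mu_n^0\right\|_s=0,\qquad \lim_{\varepsilon\to0}\ \sup_{n\in\mathbb Z,\ v\in B_s,\ \|v\|_s=1}\|(L_n^\varepsilon-L_n^0)v\|_w=0;$$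 (iv) (uniform exponential loss of memory) there are $C\ge1$, $\rho\in(0,1)$ such that for every $\varepsilon\in[0,\varepsilon_0)$, every $m<n$ and every $v\in V_s$, $\|L_{n-1}^\varepsilon\cdots L_m^\varepsilon v\|_s\le C\rho^{\,n-m}\|v\|_s$. For $0<\varepsilon<\varepsilon_0$ let $\boldsymbol h^\varepsilon:=(\boldsymbol\mu^\varepsilon-\boldsymbol\mu^0)/\varepsilon\in\mathcal B_s$. Write $L_n=L_n^0$, $\mu_n=\mu_n^0$, $\mathbb T=\mathbb T_0$, $\boldsymbol g=(g_n)_{n\in\mathbb Z}$. Then: 1. The family $(\boldsymbol h^\varepsilon)$ is bounded in $\mathcal B_s$ and the limit $\boldsymbol\eta:=\lim_{\varepsilon\to0}\boldsymbol h^\varepsilon$ exists in $\mathcal B_w$. 2. $\boldsymbol\eta\in\mathcal V_s$, and $\boldsymbol\eta$ is the unique solution in $\mathcal V_s$ of $(I-\mathbb T)\boldsymbol\eta=\mathbb S^{-1}\boldsymbol g$. Equivalently, $\boldsymbol\eta=(I-\mathbb T)^{-1}\mathbb S^{-1}\boldsymbol g=\sum_{k=0}^\infty\mathbb T^k\mathbb S^{-1}\boldsymbol g$ in $\mathcal B_s$. 3. For every $n\in\mathbb Z$, $$\eta_n=\sum_{k=0}^\infty L_{n-1}\cdots L_{n-k}\,\dot L_{n-k-1}\mu_{n-k-1}$$ (for $k=0$ the empty product is the identity, so the term is $\dot L_{n-1}\mu_{n-1}$), and the series converges absolutely in $B_s$, uniformly in $n$.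
   Context: $X$ is a separable metric space. $(B_s,\|\cdot\|_s)$ and $(B_w,\|\cdot\|_w)$ are Banach spaces of finite signed Borel measures on $X$ with $B_s\subseteq B_w$ and $\|\cdot\|_w\le\|\cdot\|_s$ on $B_s$. $\mu(X)$ is the total mass of $\mu$. $V_s:=\{\mu\in B_s:\mu(X)=0\}$ is assumed closed in $B_s$. $\mathcal B_s:=\ell^\infty(\mathbb Z;B_s)$ with norm $\|\boldsymbol\mu\|_{\mathcal B_s}=\sup_n\|\mu_n\|_s$; $\mathcal B_w:=\ell^\infty(\mathbb Z;B_w)$ similarly; $\mathcal V_s:=\ell^\infty(\mathbb Z;V_s)$ and $\mathcal V_w:=\{\boldsymbol\mu\in\mathcal B_w:\mu_n(X)=0\ \forall n\}$. $\varepsilon_0>0$. For $\varepsilon\in[0,\varepsilon_0)$ and $n\in\mathbb Z$, $L_n^\varepsilon$ is a linear operator $B_s\to B_s$ and $B_w\to B_w$, bounded uniformly in $n,\varepsilon$, which is Markov: positive and mass preserving. $\mathbb S$ is the left shift $(\mathbb S\boldsymbol\mu)_n=\mu_{n+1}$, and $\mathbb T_\varepsilon$ is defined by $(\mathbb T_\varepsilon\boldsymbol v)_n=L_{n-1}^\varepsilon v_{n-1}$. All limits $\varepsilon\to0$ are along $\varepsilon>0$. *)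

(* Defs.v *)
From HB Require Import structures.
From mathcomp Require Import all_boot all_order all_algebra.
From mathcomp Require Import all_classical all_reals all_analysis.

Set Implicit Arguments.
Unset Strict Implicit.
Unset Printing Implicit Defensive.

Import Order.TTheory GRing.Theory Num.Theory.
Import numFieldNormedType.Exports.

Local Open Scope classical_set_scope.
Local Open Scope ring_scope.

(* Measurable types are pointed in the library, so the Borel sigma-algebra of
   a metric space requires a point. *)
#[short(type="pmetricType")]
HB.structure Definition PMetric (K : numDomainType) :=
  {M of Metric K M & isPointed M}.

Definition separable (T : topologicalType) : Prop :=
  exists2 D : set T, countable D & dense D.

Notation borel T := (g_sigma_algebraType (@open T)).

(* A Banach space of finite signed Borel measures on X. Charges are finite
   signed measures, but as functions they are defined on all subsets of X, with
   arbitrary values outside the sigma-algebra; hence elements are identified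
   with their measures through their values on Borel sets only. *)
Record measureBanach (R : realType) (X : pmetricType R) := MeasureBanach {
  mb_space :> completeNormedModType R ;
  charge_of : mb_space -> {charge set (borel X) -> \bar R} ;
  charge_of_linear : forall (a : R) (u v : mb_space) (A : set (borel X)),
    measurable A ->
    charge_of (a *: u + v) A = (a%:E * charge_of u A + charge_of v A)%E ;
  charge_of_inj : forall u v : mb_space,
    (forall A : set (borel X), measurable A -> charge_of u A = charge_of v A) ->
    u = v
}.

Section measures.
Context {R : realType} {X : pmetricType R}.
Implicit Types B : measureBanach X.

Definition mass B (v : B) : R := fine (charge_of v setT).

Definition nonneg_measure B (v : B) : Prop :=
  forall A : set (borel X), measurable A -> (0 <= charge_of v A)%E.

Definition probability_measure B (v : B) : Prop :=
  nonneg_measure v /\ mass v = 1.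

(* i v is v itself, seen as an element of B2. *)
Definition measure_inclusion B1 B2 (i : B1 -> B2) : Prop :=
  forall (v : B1) (A : set (borel X)), measurable A ->
    charge_of (i v) A = charge_of v A.

End measures.

Section sequences.
Context {R : realType}.

(* The extended-real supremum is +oo on unbounded sequences. *)
Definition linfty_norm (B : normedModType R) (u : int -> B) : \bar R :=
  ereal_sup (range (fun n => `|u n|%:E)).

Definition linfty (B : normedModType R) : set (int -> B) :=
  [set u | (linfty_norm u < +oo)%E].

(* l^oo(Z; V) where V is the space of zero-mass elements of B. *)
Definition linfty0 (X : pmetricType R) (B : measureBanach X) :
    set (int -> B) :=
  [set u | linfty u /\ forall n, mass (u n) = 0].

Definition shift (B : Type) (u : int -> B) : int -> B := fun n => u (n + 1).

Definition unshift (B : Type) (u : int -> B) : int -> B := fun n => u (n - 1).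

Lemma shiftK (B : Type) : cancel (@shift B) (@unshift B).
Proof. by move=> u; apply/funext => n; rewrite /unshift /shift subrK. Qed.

Lemma unshiftK (B : Type) : cancel (@unshift B) (@shift B).
Proof. by move=> u; apply/funext => n; rewrite /unshift /shift addrK. Qed.

Definition transfer (B : lmodType R) (L : int -> {linear B -> B})
  (u : int -> B) : int -> B := fun n => L (n - 1) (u (n - 1)).

Fixpoint compose_from (B : lmodType R) (L : int -> {linear B -> B})
    (m : int) (k : nat) (v : B) : B :=
  if k is k'.+1 then L (m + k'%:Z) (compose_from L m k' v) else v.

(* L_(n-1) ... L_m for m <= n, the identity if m = n. *)
Definition cocycle (B : lmodType R) (L : int -> {linear B -> B})
  (m n : int) (v : B) : B := compose_from L m `|n - m|%N v.

End sequences.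

Arguments linfty {R} B _.
Arguments linfty0 {R X} B _.

Definition inverse_on (U : Type) (V : set U) (f J : U -> U) : Prop :=
  [/\ forall x, V x -> V (f x), forall x, V x -> V (J x),
      forall x, V x -> J (f x) = x & forall x, V x -> f (J x) = x].

(* Main.v *)
Require Import Defs.
From HB Require Import structures.
From mathcomp Require Import all_boot all_order all_algebra.
From mathcomp Require Import all_classical all_reals all_analysis.

Set Implicit Arguments.
Unset Strict Implicit.
Unset Printing Implicit Defensive.

Import Order.TTheory GRing.Theory Num.Theory.
Import numFieldNormedType.Exports.

Local Open Scope classical_set_scope.
Local Open Scope ring_scope.

(** Write [L_n] for the unperturbed operators, [mu_n] for their equivariant
    measures, [h] for the difference quotient of the equivariant families,
    [T_e] for the transfer operator on sequences at parameter [e], and [q^e_n]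
    for [(L^e_n mu_n - L_n mu_n) / e].  Subtracting the two equivariance
    relations gives the exact identity
      [h - T_e h = unshift q^e],
    so the difference quotient solves an affine equation whose forcing
    converges strongly to [unshift g].  Everything happens on sequences of
    zero-mass measures, where loss of memory makes [I - T_e] invertible with
    inverse the Neumann series, uniformly in [e].

    Boundedness: iterating [u = f + T u] exactly [N] times
    ([transfer_expansion]) and using [|T^k f| <= C rho^k |f|], any bounded
    zero-mass solution is at most [C |f| / (1 - rho)] ([solution_le]).  Applied
    to the identity above this bounds [h] for small [e]; for [e] away from [0]
    the crude bound [2 M / e] is enough ([response_bounded]).

    Solvability: the forcing [g] has zero mass because the zero-mass space is
    closed.  Its Neumann series converges geometrically in the strong norm and
    inverts [I - T_0] ([resolvent_inverse]); its sum is [eta].  The explicit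
    formula for [eta] is the Neumann series, since [T^k] evaluated at [n] is a
    cocycle of length [k] started at [n - k] ([iter_transferE]).

    Convergence: [d = h - eta] solves [d - T_e d = x] with
    [x = (L^e - L^0) eta + (q^e - g)], up to a shift.  The first term is small
    in the weak norm only, where there is no decay, so the geometric series
    cannot be summed there.  Instead [d] is expanded to a fixed order [N]
    ([weak_solution_le]): the [N] forcing terms are weakly small as [e] goes to
    [0], and the remainder [T_e^N d] is strongly at most [C rho^N |d|], small
    uniformly in [e] once [N] is large, because [h] and [eta] are strongly
    bounded ([response_weak_cvg]). *)

(** * Sup norms of sequences *)

Section sup_norms.
Context {R : realType}.

Lemma linfty_norm_le (B : normedModType R) (u : int -> B) (c : R) :
  (linfty_norm u <= c%:E)%E <-> forall n, `|u n| <= c.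
Proof.
split=> [uc n|uc].
  rewrite -lee_fin; apply: le_trans uc.
  by apply: ereal_sup_ubound; exists n.
by apply: ge_ereal_sup => _ [n _ <-]; rewrite lee_fin.
Qed.

Lemma linfty_norm_ge0 (B : normedModType R) (u : int -> B) :
  (0 <= linfty_norm u)%E.
Proof.
apply: (@le_trans _ _ `|u 0|%:E); first by rewrite lee_fin.
by apply: ereal_sup_ubound; exists 0.
Qed.

Lemma linftyP (B : normedModType R) (u : int -> B) :
  linfty B u <-> exists2 c : R, 0 <= c & forall n, `|u n| <= c.
Proof.
rewrite /linfty /=; split=> [u_fin|[c _ /linfty_norm_le uc]]; last first.
  by apply: le_lt_trans uc _; rewrite ltry.
have u_num : linfty_norm u \is a fin_num.
  by rewrite ge0_fin_numE ?linfty_norm_ge0.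
exists (fine (linfty_norm u)); first by rewrite fine_ge0 ?linfty_norm_ge0.
by apply/linfty_norm_le; rewrite fineK.
Qed.

Lemma cvge0_near_le (T : Type) (F : set_system T) {FF : Filter F}
    (f : T -> \bar R) (d : R) :
  f x @[x --> F] --> 0%E -> 0 < d -> \forall x \near F, (f x <= d%:E)%E.
Proof.
move=> /fine_cvgP[fin_f /cvgrPdist_le f0] d0; near=> x.
have fx : f x \is a fin_num by near: x.
rewrite -(fineK fx) lee_fin.
have : `|0 - fine (f x)| <= d by near: x; apply: f0.
by rewrite sub0r normrN => /(le_trans (ler_norm _)).
Unshelve. all: by end_near. Qed.

Lemma cvge0 (T : Type) (F : set_system T) {FF : Filter F} (f : T -> \bar R) :
  (forall x, (0 <= f x)%E) ->
  (forall d : R, 0 < d -> \forall x \near F, (f x <= d%:E)%E) ->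
  f x @[x --> F] --> 0%E.
Proof.
move=> f0 f_le; have fin (d : R) x : (f x <= d%:E)%E -> f x \is a fin_num.
  by move=> fd; rewrite ge0_fin_numE//; apply: le_lt_trans fd (ltry _).
apply/fine_cvgP; split; first by apply: filterS (f_le 1 ltr01); apply: fin.
apply/cvgrPdist_le => d d0; apply: filterS (f_le d d0) => x fxd.
by rewrite sub0r normrN ger0_norm ?fine_ge0// -lee_fin fineK// (fin d).
Qed.

End sup_norms.

(** * The transfer operator on sequences *)

Section transfer.
Context {R : realType} {B : lmodType R}.
Variable L : int -> {linear B -> B}.
Local Notation T := (transfer L).
Implicit Types (f u v : int -> B).

Lemma iter_transferE k f n :
  iter k T f n = compose_from L (n - k%:Z) k (f (n - k%:Z)).
Proof.
elim: k n => [|k IHk] n; first by rewrite /= subr0.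
have -> : n - k.+1%:Z = n - 1 - k%:Z by rewrite -addn1 PoszD opprD addrA addrAC.
by rewrite /= {1}/transfer IHk subrK.
Qed.

Lemma iter_transferD k u v : iter k T (u + v) = iter k T u + iter k T v.
Proof.
elim: k => //= k ->; apply/funext => n.
by rewrite /transfer /= !fctE linearD.
Qed.

(** Variation of constants: substituting the equation into itself [N] times
    leaves the forcing of the last [N] steps and the remote past. *)
Lemma transfer_expansion u f N : u - T u = f ->
  u = \sum_(0 <= k < N) iter k T f + iter N T u.
Proof.
move=> /(canRL (subrK _)) u_eq.
elim: N => [|N IHN]; first by rewrite big_geq// add0r.
rewrite big_nat_recr//= -addrA.
rewrite [X in _ + (_ + X)](_ : _ = iter N T (T u)); last by rewrite -iterS iterSr.
by rewrite -iter_transferD -u_eq.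
Qed.

End transfer.

(** * Loss of memory and the resolvent *)

Lemma geometric_sum_le (R : realType) (A rho : R) N M : 0 <= A -> 0 < rho < 1 ->
  \sum_(N <= k < M) A * rho ^+ k <= A * rho ^+ N / (1 - rho).
Proof.
move=> A0 /andP[rho0 rho1]; rewrite -mulr_sumr -mulrA; apply: ler_wpM2l => //.
have bound_ge0 : 0 <= rho ^+ N / (1 - rho).
  by rewrite divr_ge0 ?exprn_ge0 ?subr_ge0// ltW.
case: (leqP N M) => [NM|MN]; last by rewrite big_geq// ltnW.
rewrite -(subnKC NM) geometric_partial_tail; apply: geometric_le_lim => //.
  by rewrite exprn_ge0// ltW.
by rewrite ger0_norm// ltW.
Qed.

Lemma near_geometric_le (R : realType) (A rho d : R) : 0 < rho < 1 -> 0 < d ->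
  \forall N \near \oo, A * rho ^+ N <= d.
Proof.
move=> /andP[rho0 rho1] d0; have := @cvg_geometric R A rho.
rewrite ger0_norm ?(ltW rho0)// => /(_ rho1) /cvgrPdist_le/(_ d d0).
apply: filterS => N /=; rewrite sub0r normrN.
exact: le_trans (ler_norm _).
Qed.

Lemma le_of_le_geometric (R : realType) (A rho x y : R) : 0 < rho < 1 ->
  (forall N, x <= y + A * rho ^+ N) -> x <= y.
Proof.
move=> rho01 xy; apply/ler_addgt0Pr => e e0.
have [N _ /(_ N (leqnn N)) /= ANe] := near_geometric_le A rho01 e0.
by apply: le_trans (xy N) _; rewrite lerD2l.
Qed.

Section resolvent.
Context {R : realType} {B : completeNormedModType R} (V : set B).
Hypothesis V_closed : closed V.
Hypothesis V0 : V 0.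
Hypothesis VP : forall (a : R) (u v : B), V u -> V v -> V (a *: u + v).
Variable L : int -> {linear B -> B}.
Hypothesis LV : forall n v, V v -> V (L n v).
Variables C rho : R.
Hypothesis C0 : 0 <= C.
Hypothesis rho01 : 0 < rho < 1.
Hypothesis memory : forall m k v, V v ->
  `|compose_from L m k v| <= C * rho ^+ k * `|v|.
Local Notation T := (transfer L).
Implicit Types (f u v : int -> B).

Let VD (u v : B) : V u -> V v -> V (u + v).
Proof. by move=> Vu Vv; rewrite -(scale1r u); apply: VP. Qed.

Let VB (u v : B) : V u -> V v -> V (u - v).
Proof. by move=> Vu Vv; rewrite addrC -scaleN1r; apply: VP. Qed.

Lemma one_step_le n (v : B) : V v -> `|L n v| <= C * rho * `|v|.
Proof. by move=> /(memory n 1) /=; rewrite addr0 expr1. Qed.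

Lemma iter_transfer_sub k f : (forall n, V (f n)) -> forall n, V (iter k T f n).
Proof. by move=> Vf; elim: k => //= k IHk n; apply: LV. Qed.

Lemma iter_transfer_le k f (F : R) : (forall n, V (f n)) ->
  (forall n, `|f n| <= F) -> forall n, `|iter k T f n| <= C * F * rho ^+ k.
Proof.
move=> Vf fF n; rewrite iter_transferE; apply: le_trans (memory _ _ (Vf _)) _.
rewrite mulrAC ler_wpM2r//; first by rewrite exprn_ge0// ltW//; case/andP: rho01.
by rewrite ler_wpM2l.
Qed.

(** Letting the remote past recede to [-oo] removes it, by loss of memory: the
    bound [U] on the solution enters the hypotheses but not the conclusion. *)
Lemma solution_le u f (U F : R) : u - T u = f ->
  (forall n, V (u n)) -> (forall n, V (f n)) ->
  (forall n, `|u n| <= U) -> (forall n, `|f n| <= F) ->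
  forall n, `|u n| <= C * F / (1 - rho).
Proof.
move=> u_eq Vu Vf uU fF n.
have F0 : 0 <= F := le_trans (normr_ge0 _) (fF 0).
apply: (@le_of_le_geometric _ (C * U) rho) => // N.
rewrite (transfer_expansion N u_eq) fctE fct_sumE.
apply: le_trans (ler_normD _ _) (lerD _ (iter_transfer_le N Vu uU n)).
apply: le_trans (ler_norm_sum _ _ _) _.
apply: (@le_trans _ _ (\sum_(0 <= k < N) C * F * rho ^+ k)).
  by apply: ler_sum => k _; apply: iter_transfer_le.
by rewrite -[X in X / _]mulr1 -(expr0 rho) geometric_sum_le// mulr_ge0.
Qed.

Lemma solution_unique u v f : u - T u = f -> v - T v = f ->
  (forall n, V (u n)) -> (forall n, V (v n)) ->
  linfty B u -> linfty B v -> u = v.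
Proof.
move=> u_eq v_eq Vu Vv /linftyP[a _ ua] /linftyP[b _ vb].
have d_eq : (u - v) - T (u - v) = 0.
  have -> : T (u - v) = T u - T v.
    by apply/funext => n; rewrite /transfer !fctE linearB.
  by rewrite opprD opprK addrACA u_eq [- v + _]addrC -opprB v_eq subrr.
apply/funext => n; apply/eqP; rewrite -subr_eq0 -normr_le0.
have := @solution_le (u - v) 0 (a + b) 0 d_eq.
rewrite mulr0 mul0r; apply=> m.
- exact: VB.
- exact: V0.
- by apply: le_trans (ler_normB _ _) _; rewrite lerD.
- by rewrite normr0.
Qed.

Definition resolvent f : int -> B :=
  fun n => limn (series (fun k => iter k T f n)).

Section bounded_forcing.
Variables (f : int -> B) (F : R).
Hypotheses (Vf : forall n, V (f n)) (fF : forall n, `|f n| <= F).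

Let F0 : 0 <= F.
Proof. exact: le_trans (normr_ge0 _) (fF 0). Qed.

Lemma neumann_tail_le N M n :
  \sum_(N <= k < M) `|iter k T f n| <= C * F * rho ^+ N / (1 - rho).
Proof.
apply: le_trans (geometric_sum_le N M _ rho01); last by rewrite mulr_ge0.
by apply: ler_sum => k _; apply: iter_transfer_le.
Qed.

Lemma neumann_normed_cvg n : cvgn [normed series (fun k => iter k T f n)].
Proof.
apply: nondecreasing_is_cvgn.
  by apply/nondecreasing_seqP => N; rewrite [leRHS]big_nat_recr//= lerDl.
by exists (C * F * rho ^+ 0 / (1 - rho)) => _ [N _ <-]; apply: neumann_tail_le.
Qed.

Lemma neumann_cvg n :
  series (fun k => iter k T f n) @ \oo --> resolvent f n.
Proof. exact/normed_cvg/neumann_normed_cvg. Qed.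

Lemma resolvent_tail_le N n :
  `|resolvent f n - \sum_(0 <= k < N) iter k T f n|
    <= C * F * rho ^+ N / (1 - rho).
Proof.
set s := series (fun k => iter k T f n).
apply: (@closed_cvg _ _ \oo _ (fun M => `|s M - s N|) (fun x => x <= _)).
- exact: closed_le.
- exists N => //= M NM; rewrite /s sub_series_geq//.
  by apply: le_trans (ler_norm_sum _ _ _) _; apply: neumann_tail_le.
- by apply: cvg_norm; apply: cvgB; [exact: neumann_cvg|exact: cvg_cst].
Qed.

Lemma resolvent_le n : `|resolvent f n| <= C * F / (1 - rho).
Proof.
by have := resolvent_tail_le 0 n; rewrite big_geq// subr0 expr0 mulr1.
Qed.

Lemma resolvent_sub n : V (resolvent f n).
Proof.
apply: (closed_cvg V V_closed _ _ (@neumann_cvg n)).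
near=> N; rewrite /series/=.
by elim/big_ind: _ => [||k _]; [|exact: VD|exact: iter_transfer_sub].
Unshelve. all: by end_near. Qed.

(** The partial sums [s_N] satisfy [s_(N+1) = f + T s_N]; passing to the limit
    uses only that one step of the dynamics is Lipschitz on [V], which is loss of
    memory with [k = 1]. *)
Lemma resolvent_eq : resolvent f - T (resolvent f) = f.
Proof.
apply/funext => n; rewrite !fctE; apply/eqP; rewrite -subr_eq0 -normr_le0.
set A := C * F / (1 - rho).
apply: (@le_of_le_geometric _ (A * rho + C * rho * A) rho) => // N.
rewrite add0r mulrDl.
have -> : resolvent f n - T (resolvent f) n - f n =
    (resolvent f n - \sum_(0 <= k < N.+1) iter k T f n)
    - L (n - 1) (resolvent f (n - 1) - \sum_(0 <= k < N) iter k T f (n - 1)).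
  rewrite linearB big_nat_recl//= [X in _ = _ - (_ - X)]linear_sum /transfer.
  by rewrite opprB opprD !addrA subrK addrAC.
apply: le_trans (ler_normB _ _) (lerD _ _).
  by rewrite -mulrA -exprS [leRHS]mulrAC; apply: resolvent_tail_le.
apply: le_trans (one_step_le _ _) _.
  apply: VB; first exact: resolvent_sub.
  by elim/big_ind: _ => [||k _]; [|exact: VD|exact: iter_transfer_sub].
rewrite -[leRHS]mulrA; apply: ler_wpM2l.
  by case/andP: rho01 => rho0 _; rewrite mulr_ge0// ltW.
by rewrite [leRHS]mulrAC; apply: resolvent_tail_le.
Qed.

Lemma neumann_uniform_cvg :
  linfty_norm (resolvent f - \sum_(0 <= k < N) iter k T f) @[N --> \oo] --> 0%E.
Proof.
apply: cvge0 => [N|]; first exact: linfty_norm_ge0.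
move=> d d0; have := near_geometric_le (C * F / (1 - rho)) rho01 d0.
apply: filterS => N Nd; apply/linfty_norm_le => n.
rewrite !fctE fct_sumE; apply: le_trans (resolvent_tail_le N n) _.
by rewrite mulrAC.
Qed.

Lemma neumann_abs_tail_cvg :
  ereal_sup (range (fun n => \sum_(N <= k <oo) `|iter k T f n|%:E)%E)
    @[N --> \oo] --> 0%E.
Proof.
have tail_ge0 N n : (0 <= \sum_(N <= k <oo) `|iter k T f n|%:E)%E.
  by apply: nneseries_ge0 => k _ _; rewrite lee_fin.
apply: cvge0 => [N|].
  apply: le_trans (tail_ge0 N 0) _.
  by apply: ereal_sup_ubound; exists 0.
move=> d d0; have := near_geometric_le (C * F / (1 - rho)) rho01 d0.
apply: filterS => N Nd; apply: ge_ereal_sup => _ [n _ <-].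
apply: lime_le; first by apply: is_cvg_nneseries => k _ _; rewrite lee_fin.
apply: nearW => M; rewrite sumEFin lee_fin.
by apply: le_trans (neumann_tail_le N M n) _; rewrite mulrAC.
Qed.

End bounded_forcing.

(** The Neumann series gives a right inverse; being injective by
    [solution_unique], [I - T] then has it as a left inverse too. *)
Lemma resolvent_inverse :
  inverse_on [set u | linfty B u /\ forall n, V (u n)] (fun v => v - T v)
    resolvent.
Proof.
set S := [set u | _].
have ST v : S v -> S (v - T v).
  move=> [/linftyP[c c0 vc] Vv]; split=> [|n]; last first.
    by rewrite !fctE; apply: VB => //; apply: LV.
  apply/linftyP; exists (c + C * c * rho ^+ 1).
    by rewrite addr_ge0// !mulr_ge0// expr1 ltW//; case/andP: rho01.
  move=> n; rewrite !fctE; apply: le_trans (ler_normB _ _) (lerD _ _) => //.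
  exact: (@iter_transfer_le 1).
have SJ f : S f -> S (resolvent f).
  move=> [/linftyP[c c0 fc] Vf]; split=> [|n]; last exact: resolvent_sub fc n.
  apply/linftyP; exists (C * c / (1 - rho)); last exact: resolvent_le.
  by rewrite divr_ge0 ?mulr_ge0// subr_ge0 ltW//; case/andP: rho01.
have TJ f : S f -> resolvent f - T (resolvent f) = f.
  by move=> [/linftyP[c _ fc] Vf]; apply: resolvent_eq fc.
split=> // v Sv.
have [JvF VJv] := SJ _ (ST _ Sv); have [vF Vv] := Sv.
exact: (solution_unique (TJ _ (ST _ Sv)) erefl).
Qed.

End resolvent.

(** * Weak estimates for strong solutions *)

Section weak.
Context {R : realType} {B W : normedModType R} (i : {linear B -> W}).
Variables (L : int -> {linear B -> B}) (Lw : int -> {linear W -> W}) (K : R).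
Hypothesis iL : forall n v, i (L n v) = Lw n (i v).
Hypothesis Lw_le : forall n w, `|Lw n w| <= K * `|w|.
Hypothesis K0 : 0 <= K.
Local Notation T := (transfer L).

Lemma weak_iter_transfer_le (f : int -> B) (r : R) k :
  (forall n, `|i (f n)| <= r) -> forall n, `|i (iter k T f n)| <= K ^+ k * r.
Proof.
move=> fr; elim: k => [|k IHk] n; first by rewrite mul1r.
rewrite /= {1}/transfer iL exprS -mulrA; apply: le_trans (Lw_le _ _) _.
by rewrite ler_wpM2l.
Qed.

(** A bound on the truncated expansion that needs no decay in the weak norm: the
    remainder is controlled by hypothesis, and the [N] forcing terms by crude
    powers of the weak operator bound. *)
Lemma weak_solution_le (u f : int -> B) (r t : R) N : u - T u = f ->
  (forall n, `|i (f n)| <= r) -> (forall n, `|i (iter N T u n)| <= t) ->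
  forall n, `|i (u n)| <= (\sum_(0 <= k < N) K ^+ k) * r + t.
Proof.
move=> u_eq fr ut n; rewrite (transfer_expansion N u_eq) fctE fct_sumE.
rewrite linearD linear_sum; apply: le_trans (ler_normD _ _) (lerD _ (ut n)).
rewrite mulr_suml; apply: le_trans (ler_norm_sum _ _ _) _.
by apply: ler_sum => k _; apply: weak_iter_transfer_le.
Qed.

End weak.

(** * Linear response in an abstract pair of spaces *)

Section response.
Context {R : realType} {B W : completeNormedModType R} (i : {linear B -> W}).
Hypothesis i_le : forall v, `|i v| <= `|v|.
Variable V : set B.
Hypothesis V_closed : closed V.
Hypothesis V0 : V 0.
Hypothesis VP : forall (a : R) (u v : B), V u -> V v -> V (a *: u + v).
Variables (eps0 : R) (Ls : R -> int -> {linear B -> B}).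
Variables (Lw : R -> int -> {linear W -> W}) (K C rho : R).
Hypothesis eps0_gt0 : 0 < eps0.
Hypothesis iL : forall (e : R) n v, 0 <= e < eps0 ->
  i (Ls e n v) = Lw e n (i v).
Hypothesis K0 : 0 <= K.
Hypothesis Lw_le : forall (e : R) n w, 0 <= e < eps0 ->
  `|Lw e n w| <= K * `|w|.
Hypothesis C0 : 0 <= C.
Hypothesis rho01 : 0 < rho < 1.
Hypothesis memory : forall e : R, 0 <= e < eps0 -> forall m k v, V v ->
  `|compose_from (Ls e) m k v| <= C * rho ^+ k * `|v|.
Variables (mu : R -> int -> B) (g : int -> B) (M G : R).
Hypothesis mu_equivariant : forall (e : R) n, 0 <= e < eps0 ->
  mu e (n + 1) = Ls e n (mu e n).
Hypothesis muM : forall (e : R) n, 0 <= e < eps0 -> `|mu e n| <= M.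
Hypothesis V_mu : forall (e : R) n, 0 <= e < eps0 -> V (mu e n - mu 0 n).
Hypothesis V_step : forall (e : R) n, 0 <= e < eps0 ->
  V (Ls e n (mu 0 n) - Ls 0 n (mu 0 n)).
Hypothesis gG : forall n, `|g n| <= G.
Local Notation q e :=
  (fun n : int => e^-1 *: (Ls e n (mu 0 n) - Ls 0 n (mu 0 n))).
Local Notation h e := (fun n : int => e^-1 *: (mu e n - mu 0 n)).
Hypothesis L_diff : linfty_norm (fun n => q e n - g n) @[e --> 0^'+] --> 0%E.

Let e_in (e : R) : 0 < e < eps0 -> 0 <= e < eps0.
Proof. by case/andP=> e_gt0 ->; rewrite ltW. Qed.

Let e0_in : 0 <= (0 : R) < eps0.
Proof. by rewrite lexx. Qed.

Let near_in : \forall e \near (0 : R)^'+, 0 < e < eps0.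
Proof.
near=> e; apply/andP; split; near: e; first exact: nbhs_right_gt.
exact: nbhs_right_lt.
Unshelve. all: by end_near. Qed.

Let VB (u v : B) : V u -> V v -> V (u - v).
Proof. by move=> Vu Vv; rewrite addrC -scaleN1r; apply: VP. Qed.

Let VZ (a : R) (u : B) : V u -> V (a *: u).
Proof. by move=> Vu; rewrite -[_ *: _]addr0; apply: VP. Qed.

Let M0 : 0 <= M.
Proof. exact: le_trans (normr_ge0 _) (muM 0 e0_in). Qed.

Let G0 : 0 <= G.
Proof. exact: le_trans (normr_ge0 _) (gG 0). Qed.

Lemma quotient_near_le (d : R) : 0 < d ->
  \forall e \near 0^'+, forall n, `|q e n - g n| <= d.
Proof.
move=> d0; apply: filterS (cvge0_near_le L_diff d0) => e.
by move=> /linfty_norm_le.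
Qed.

(** The difference quotients of the operators lie in [V] and converge strongly,
    so closedness of [V] puts their limit there. *)
Lemma derivative_sub n : V (g n).
Proof.
apply: (@closed_cvg _ _ (0 : R)^'+ _ (fun e => q e n) V V_closed).
  by apply: filterS near_in => e /e_in ee; apply/VZ/V_step.
apply/cvgrPdist_le => d /quotient_near_le; apply: filterS => e /(_ n).
by rewrite distrC.
Qed.

Lemma response_equation (e : R) : 0 <= e < eps0 ->
  h e - transfer (Ls e) (h e) = unshift (q e).
Proof.
move=> ee; apply/funext => n; rewrite !fctE /transfer /unshift.
rewrite -{1 2}(subrK 1 n) !mu_equivariant// linearZ/= -scalerBr.
by congr (_ *: _); rewrite linearB opprB addrC addrA subrK.
Qed.

Let h_le (e : R) n : 0 < e < eps0 -> `|h e n| <= e^-1 * (M + M).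
Proof.
move=> ee; have /andP[e_gt0 _] := ee.
rewrite normrZ gtr0_norm ?invr_gt0//; apply: ler_wpM2l.
  by rewrite invr_ge0 ltW.
by apply: le_trans (ler_normB _ _) (lerD _ _); apply: muM => //; apply: e_in.
Qed.

(** Near [0] the equation bounds [h] by its forcing, the crude bound [h_le]
    serving only as the qualitative boundedness that [solution_le] asks for; at
    distance [d] from [0] the crude bound is itself uniform. *)
Lemma response_bounded : exists2 H : R, 0 <= H &
  forall e : R, 0 < e < eps0 -> forall n, `|h e n| <= H.
Proof.
have [d /= d0 dq] := quotient_near_le ltr01.
set A := C * (G + 1) / (1 - rho).
have A0 : 0 <= A.
  have /andP[_ rho1] := rho01.
  by rewrite divr_ge0 ?subr_ge0 ?(ltW rho1)// mulr_ge0 ?addr_ge0.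
have D0 : 0 <= d^-1 * (M + M) by rewrite mulr_ge0 ?addr_ge0// invr_ge0 ltW.
exists (A + d^-1 * (M + M)); first exact: addr_ge0.
move=> e ee n; have /andP[e_gt0 _] := ee.
case: (ltP e d) => [ed|de].
  apply: (@le_trans _ _ A); last by rewrite lerDl.
  apply: (solution_le C0 rho01 (memory (e_in ee)) (response_equation (e_in ee))).
  - by move=> m; apply/VZ/V_mu/e_in.
  - by move=> m; apply/VZ/V_step/e_in.
  - by move=> m; apply: h_le.
  - move=> m; rewrite /unshift -[X in `|X|](subrK (g (m - 1))) addrC.
    apply: le_trans (ler_normD _ _) (lerD _ _) => //.
    by apply: dq => //=; rewrite sub0r normrN gtr0_norm.
apply: le_trans (h_le n ee) _; rewrite ler_wpDl//.
by apply: ler_wpM2r; rewrite ?addr_ge0// lef_pV2.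
Qed.

Hypothesis L_cont : ereal_sup [set `|i (Ls e nv.1 nv.2 - Ls 0 nv.1 nv.2)|%:E
    | nv in [set nv : int * B | `|nv.2| = 1]] @[e --> 0^'+] --> 0%E.

(** The hypothesis sees only unit vectors, so [v] is normalized. *)
Lemma operators_near_le (d : R) : 0 < d -> \forall e \near 0^'+, forall n v,
  `|i (Ls e n v - Ls 0 n v)| <= d * `|v|.
Proof.
move=> d0; apply: filterS (cvge0_near_le L_cont d0) => e Led n v.
have [->|v0] := eqVneq v 0.
  by rewrite !(linear0 (Ls _ _)) subr0 linear0 !normr0 mulr0.
have nv0 : 0 < `|v| by rewrite normr_gt0.
rewrite -ler_pdivrMr// mulrC -[X in X * _]gtr0_norm ?invr_gt0// -normrZ.
rewrite -linearZ/= scalerBr -!linearZ/= -lee_fin.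
apply: le_trans Led; apply: ereal_sup_ubound.
exists (n, `|v|^-1 *: v) => //=.
by rewrite normrZ normfV normr_id mulVf// lt0r_neq0.
Qed.

Section limit.
Variables (eta : int -> B) (E : R).
Hypothesis eta_eq : eta - transfer (Ls 0) eta = unshift g.
Hypothesis V_eta : forall n, V (eta n).
Hypothesis etaE : forall n, `|eta n| <= E.

Lemma response_error_equation (e : R) : 0 <= e < eps0 ->
  h e - eta - transfer (Ls e) (h e - eta) =
  (fun n => (Ls e (n - 1) (eta (n - 1)) - Ls 0 (n - 1) (eta (n - 1))) +
            (q e (n - 1) - g (n - 1))).
Proof.
move=> /response_equation; move: (h e) => u u_eq; apply/funext => n.
have := congr1 (@^~ n) u_eq; have := congr1 (@^~ n) eta_eq.
rewrite /transfer /unshift !fctE (linearB (Ls e (n - 1))) => <- <-.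
rewrite !opprB [_ - _ + (_ - eta n)]addrC [RHS]addrA [_ - _ + (_ - eta n)]addrA.
by rewrite subrK addrC addrACA [RHS]addrACA [X in _ + X]addrC.
Qed.

(** Mixed argument: decay comes from the strong norm and is used only through
    the remainder of a truncated expansion; smallness of the forcing comes from
    the weak norm and is used only over the finitely many terms of that
    expansion.  Hence the order of the choices: [N] first, then [e]. *)
Lemma response_weak_cvg :
  linfty_norm (fun n => i (h e n) - i (eta n)) @[e --> 0^'+] --> 0%E.
Proof.
have [H H0 hH] := response_bounded.
have E0 : 0 <= E := le_trans (normr_ge0 _) (etaE 0).
apply: cvge0 => [e|d d0]; first exact: linfty_norm_ge0.
have d2 : 0 < d / 2 by rewrite divr_gt0.
have [N _ /(_ N (leqnn N)) /= Nd] :=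
  near_geometric_le (C * (H + E)) rho01 d2.
set S := \sum_(0 <= k < N) K ^+ k.
have S0 : 0 <= S by rewrite sumr_ge0// => k _; rewrite exprn_ge0.
have SE0 : 0 < (S + 1) * (E + 1) by rewrite mulr_gt0// ltr_wpDl.
(* The forcing is weakly at most [c * (E + 1)] and [N] of its iterates cost a
   factor [S]; the extra 1 keeps the denominator positive when [N = 0]. *)
pose c := d / 2 / ((S + 1) * (E + 1)).
have c0 : 0 < c by rewrite divr_gt0.
near=> e.
have ee : 0 <= e < eps0 by apply: e_in; near: e.
have qe : forall n, `|q e n - g n| <= c by near: e; apply: quotient_near_le.
have Le : forall n v, `|i (Ls e n v - Ls 0 n v)| <= c * `|v|.
  by near: e; apply: operators_near_le.
have Vd n : V ((h e - eta) n) by apply: VB => //; apply/VZ/V_mu.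
have dHE n : `|(h e - eta) n| <= H + E.
  apply: le_trans (ler_normB _ _) (lerD _ _) => //.
  by apply: hH; near: e.
have weak := weak_solution_le (fun n v => iL n v ee) (fun n w => Lw_le n w ee)
  K0 (response_error_equation ee) (r := c * (E + 1)) (t := d / 2) (N := N).
apply/linfty_norm_le => n.
rewrite -linearB; apply: le_trans (weak _ _ n) _ => [m|m|].
- rewrite linearD mulrDr mulr1; apply: le_trans (ler_normD _ _) (lerD _ _).
    by apply: le_trans (Le _ _) _; rewrite ler_wpM2l// ltW.
  exact: le_trans (i_le _) (qe _).
- apply: le_trans (i_le _) _; apply: le_trans Nd.
  exact: (iter_transfer_le C0 rho01 (memory ee) N Vd dHE m).
- rewrite [leRHS]splitr lerD2r -/S.
  apply: (@le_trans _ _ ((S + 1) * (c * (E + 1)))).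
    by rewrite ler_wpM2r ?lerDl// mulr_ge0 ?addr_ge0// ltW.
  by rewrite mulrCA /c divfK// gt_eqF.
Unshelve. all: by end_near. Qed.

End limit.
End response.

(** * Spaces of measures *)

Section measure_spaces.
Context {R : realType} {X : pmetricType R}.

Lemma mass_linear (B : measureBanach X) (a : R) (u v : B) :
  mass (a *: u + v) = a * mass u + mass v.
Proof.
have fin w : charge_of w setT \is a fin_num by apply: fin_num_measure.
rewrite /mass charge_of_linear//.
by rewrite fineD ?fineM ?fin_numM ?fin.
Qed.

Lemma mass0 (B : measureBanach X) : mass (0 : B) = 0.
Proof.
by rewrite -{1}(subrr (0 : B)) addrC -scaleN1r mass_linear mulN1r addNr.
Qed.

(** An element is determined by its values on Borel sets, on which the
    inclusion changes nothing and the linear structures of both spaces agree. *)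
Lemma measure_inclusion_linear (B1 B2 : measureBanach X) (i : B1 -> B2) :
  measure_inclusion i -> linear i.
Proof.
move=> iE a u v; apply: charge_of_inj => A mA.
by rewrite charge_of_linear// !iE// charge_of_linear.
Qed.

End measure_spaces.

Lemma cocycleE (R : realType) (B : lmodType R) (L : int -> {linear B -> B})
  m k v : cocycle L m (m + k%:Z) v = compose_from L m k v.
Proof. by rewrite /cocycle addrC addKr. Qed.

Theorem theorem11 (R : realType) (X : pmetricType R)
  (X_separable : separable X)
  (Bs Bw : measureBanach X)
  (inc : Bs -> Bw)
  (inc_incl : measure_inclusion inc)
  (inc_norm : forall v : Bs, `|inc v| <= `|v|)
  (Vs_closed : closed [set v : Bs | mass v = 0])
  (eps0 : R) (eps0_gt0 : 0 < eps0)
  (Ls : R -> int -> {linear Bs -> Bs})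
  (Lw : R -> int -> {linear Bw -> Bw})
  (L_compat : forall (e : R) n v, 0 <= e < eps0 -> inc (Ls e n v) = Lw e n (inc v))
  (Ls_bounded : exists K : R, forall (e : R) n v, 0 <= e < eps0 ->
    `|Ls e n v| <= K * `|v|)
  (Lw_bounded : exists K : R, forall (e : R) n v, 0 <= e < eps0 ->
    `|Lw e n v| <= K * `|v|)
  (L_positive : forall (e : R) n v, 0 <= e < eps0 ->
    nonneg_measure v -> nonneg_measure (Lw e n v))
  (L_mass : forall (e : R) n v, 0 <= e < eps0 -> mass (Ls e n v) = mass v)
  (* (i) *)
  (Tw_stable : forall e : R, 0 <= e < eps0 ->
    forall u, linfty0 Bw u -> linfty0 Bw (transfer (Lw e) u))
  (Tw_power_bounded : exists2 Mw : R, 1 <= Mw &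
    forall (k : nat) (e : R), 0 <= e < eps0 -> forall u, linfty0 Bw u ->
      (linfty_norm (iter k (transfer (Lw e)) u) <= Mw%:E * linfty_norm u)%E)
  (* (ii) *)
  (mu : R -> int -> Bs)
  (mu_linfty : forall e : R, 0 <= e < eps0 -> linfty Bs (mu e))
  (mu_proba : forall (e : R) n, 0 <= e < eps0 -> probability_measure (mu e n))
  (mu_equivariant : forall (e : R) n, 0 <= e < eps0 ->
    mu e (n + 1) = Ls e n (mu e n))
  (mu_bounded :
    (ereal_sup [set linfty_norm (mu e) | e in [set e : R | (0 <= e < eps0)%R]]
      < +oo)%E)
  (* (iii) *)
  (g : int -> Bs)
  (g_linfty : linfty Bs g)
  (L_diff : linfty_norm (fun n : int =>
      e^-1 *: (Ls e n (mu 0 n) - Ls 0 n (mu 0 n)) - g n)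
    @[e --> 0^'+] --> 0%E)
  (L_cont : ereal_sup [set `|inc (Ls e nv.1 nv.2 - Ls 0 nv.1 nv.2)|%:E
      | nv in [set nv : int * Bs | `|nv.2| = 1]]
    @[e --> 0^'+] --> 0%E)
  (* (iv) *)
  (L_memory : exists C rho : R, [/\ 1 <= C, 0 < rho < 1 &
    forall e : R, 0 <= e < eps0 -> forall m n : int, m < n ->
    forall v : Bs, mass v = 0 ->
      `|cocycle (Ls e) m n v| <= C * rho ^ (n - m) * `|v|]) :
  let h (e : R) : int -> Bs := fun n => e^-1 *: (mu e n - mu 0 n) in
  let T : (int -> Bs) -> (int -> Bs) := transfer (Ls 0) in
  let term (n : int) (k : nat) : Bs :=
    cocycle (Ls 0) (n - k%:Z) n (g (n - k%:Z - 1)) in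
  (* 1. *)
  (ereal_sup [set linfty_norm (h e) | e in [set e : R | (0 < e < eps0)%R]]
    < +oo)%E /\
  exists etaw : int -> Bw,
    [/\ linfty Bw etaw,
        linfty_norm (fun n => inc (h e n) - etaw n) @[e --> 0^'+] --> 0%E &
  (* 2. *)
  exists eta : int -> Bs,
    [/\ etaw = inc \o eta,
        [/\ linfty0 Bs eta,
            eta - T eta = unshift g &
            forall v, linfty0 Bs v -> v - T v = unshift g -> v = eta],
        [/\ linfty0 Bs (unshift g),
            exists2 J, inverse_on (linfty0 Bs) (fun v => v - T v) J &
              eta = J (unshift g) &
            linfty_norm (eta - \sum_(0 <= k < N) iter k T (unshift g))
              @[N --> \oo] --> 0%E] &
  (* 3. *)
        [/\ forall n, series (term n) @ \oo --> eta n,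
            forall n, cvgn [normed series (term n)] &
            ereal_sup (range (fun n : int =>
              (\sum_(N <= k <oo) `|term n k|%:E)%E))
              @[N --> \oo] --> 0%E]]].
Proof.
set V := [set v : Bs | mass v = 0] in Vs_closed.
have V0 : V 0 by apply: mass0.
have VP (a : R) (u v : Bs) : V u -> V v -> V (a *: u + v).
  by rewrite /V /= mass_linear => -> ->; rewrite mulr0 addr0.
have VB (u v : Bs) : mass u = mass v -> V (u - v).
  by move=> uv; rewrite /V /= addrC -scaleN1r mass_linear uv mulN1r addNr.
have [C [rho [C1 rho01 memC]]] := L_memory.
have C0 : 0 <= C by apply: le_trans C1.
have memory (e : R) : 0 <= e < eps0 -> forall m k v, V v ->
    `|compose_from (Ls e) m k v| <= C * rho ^+ k * `|v|.
  move=> ee m [|k] v Vv; first by rewrite /= mulr1 ler_peMl.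
  rewrite -cocycleE; apply: le_trans (memC e ee m (m + k.+1%:Z) _ v Vv) _.
    by rewrite ltrDl.
  by rewrite [m + _]addrC addrK.
have e0_in : 0 <= (0 : R) < eps0 by rewrite lexx.
have [M muM] : exists M : R,
    forall (e : R) n, 0 <= e < eps0 -> `|mu e n| <= M.
  set s := ereal_sup _ in mu_bounded.
  have mu_s (e : R) : 0 <= e < eps0 -> (linfty_norm (mu e) <= s)%E.
    by move=> ee; apply: ereal_sup_ubound; exists e.
  have s0 : (0 <= s)%E := le_trans (linfty_norm_ge0 _) (mu_s 0 e0_in).
  have s_fin : s \is a fin_num by rewrite ge0_fin_numE.
  exists (fine s) => e n ee; move: n; apply/linfty_norm_le.
  by rewrite fineK// mu_s.
have V_mu (e : R) n : 0 <= e < eps0 -> V (mu e n - mu 0 n).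
  by move=> ee; apply: VB; rewrite (mu_proba e n ee).2 (mu_proba 0 n e0_in).2.
have V_step (e : R) n : 0 <= e < eps0 ->
    V (Ls e n (mu 0 n) - Ls 0 n (mu 0 n)).
  by move=> ee; apply: VB; rewrite !L_mass.
have [G G0 gG] := (linftyP g).1 g_linfty.
have [Kw LwK] := Lw_bounded.
have Lw_le (e : R) n w : 0 <= e < eps0 -> `|Lw e n w| <= `|Kw| * `|w|.
  move=> ee; apply: le_trans (LwK e n w ee) _.
  by apply: ler_wpM2r => //; apply: ler_norm.
pose i : {linear Bs -> Bw} := HB.pack inc
  (GRing.isLinear.Build R Bs Bw _ inc (measure_inclusion_linear inc_incl)).
move=> h T term; split.
  have [H H0 hH] := response_bounded V0 VP eps0_gt0 C0 rho01 memory
    mu_equivariant muM V_mu V_step gG L_diff.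
  apply: (@le_lt_trans _ _ H%:E); last exact: ltry.
  by apply: ge_ereal_sup => _ [e ee <-]; apply/linfty_norm_le; apply: hH.
have memory0 := memory 0 e0_in.
have LV0 n v : V v -> V (Ls 0 n v) by rewrite /V /= L_mass.
have uG n : `|unshift g n| <= G by apply: gG.
have Vu n : V (unshift g n).
  exact: (derivative_sub Vs_closed V0 VP eps0_gt0 V_step L_diff).
have J_inv := resolvent_inverse Vs_closed V0 VP LV0 C0 rho01 memory0.
have [_ SJ _ TJ] := J_inv.
have Su : linfty0 Bs (unshift g) by split=> //; apply/linftyP; exists G.
pose eta := resolvent (Ls 0) (unshift g).
have Seta : linfty0 Bs eta by apply: SJ.
have eta_eq : eta - T eta = unshift g by apply: TJ.
have [E E0 etaE] := (linftyP eta).1 Seta.1.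
have termE n : term n = (fun k => iter k T (unshift g) n).
  apply/funext => k; rewrite iter_transferE /term.
  by rewrite -[X in cocycle _ _ X](subrK k%:Z n) cocycleE.
exists (inc \o eta); split.
- by apply/linftyP; exists E => // n; apply: le_trans (inc_norm _) _.
- exact: (response_weak_cvg (i := i) inc_norm V0 VP eps0_gt0
    (fun e n v => @L_compat e n v) (normr_ge0 _) Lw_le C0 rho01 memory
    mu_equivariant muM V_mu V_step gG L_diff L_cont eta_eq Seta.2 etaE).
exists eta; split=> //; first split=> //.
- move=> v [vb Vv] v_eq.
  exact: (solution_unique V0 VP C0 rho01 memory0 v_eq eta_eq Vv Seta.2 vb Seta.1).
- split=> //; last exact: (neumann_uniform_cvg C0 rho01 memory0 Vu uG).
  by exists (resolvent (Ls 0)).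
split=> [n|n|].
- rewrite termE; exact: (neumann_cvg C0 rho01 memory0 Vu uG).
- rewrite termE; exact: (neumann_normed_cvg C0 rho01 memory0 Vu uG).
- under eq_fun do under eq_fun do rewrite termE.
  exact: (neumann_abs_tail_cvg C0 rho01 memory0 Vu uG).
Qed.
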